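(* Consider a common-payoff finite-horizon partially observable stochastic game with finite action sets, and let $\pi^t$ be a joint policy that assigns positive probability to every action at every decision point. For a stepsize $\eta > 0$, define the joint policy $\pi^{t+1}$ by performing a mirror descent (hedge) update simultaneously at every decision point of every player with action-value feedback: for each player $i$ and each decision point $h_i$ reached with positive probability under $\pi^t$, $$\pi^{t+1}_i(h_i) = \arg\max_{\bar{\pi}' \in \Delta(\mathbb{A}_i)} \langle \bar{\pi}', q_i^{\pi^t}(h_i)\rangle - \tfrac{1}{\eta}\mathrm{KL}(\bar{\pi}', \pi_i^t(h_i)), \quad\text{i.e.}\quad \pi^{t+1}_i(h_i)(a) \propto \pi^t_i(h_i)(a)\, e^{\eta\, q_i^{\pi^t}(h_i, a)}.$$ Then for every sufficiently small stepsize $\eta > 0$, $\mathcal{J}(\pi^{t+1}) \geq \mathcal{J}(\pi^t)$, and this inequality is strict if $\pi^{t+1} \neq \pi^t$.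
   Context: A finite-horizon partially observable stochastic game (POSG) consists of finite sets of Markov states $\mathbb{S}$, per-player action sets $\mathbb{A}_i$ and observation sets $\mathbb{O}_i$, joint actions $\mathbb{A} = \times_i \mathbb{A}_i$, reward functions $\mathcal{R}_i \colon \mathbb{S}\times\mathbb{A}\to\mathbb{R}$, a transition function $\mathcal{T}\colon \mathbb{S}\times\mathbb{A}\to\Delta(\mathbb{S})$ and observation functions $\mathcal{O}_i \colon \mathbb{S}\times\mathbb{A}\to\mathbb{O}_i$. Player $i$'s decision points are $h_i \in \mathbb{H}_i = \bigcup_t (\mathbb{O}_i\times\mathbb{A}_i)^t\times\mathbb{O}_i$; histories are $h \in \mathbb{H} = \times_i \mathbb{H}_i$. A policy for player $i$ is a map $\pi_i\colon \mathbb{H}_i \to \Delta(\mathbb{A}_i)$, and a joint policy is $\pi = (\pi_i)_i$; $\mathcal{P}_\pi$, $\mathbb{E}_\pi$ denote probabilities/expectations induced by $\pi$. The expected return of player $i$ is $\mathcal{J}_i(\pi) = \mathbb{E}_\pi[\sum_t \mathcal{R}_i(S^t, A^t)]$; the game is common-payoff if all players' returns coincide, and then $\mathcal{J}$ denotes this common expected return. For a history $h^t$ at time $t$, $G^{\geq t} = \sum_{t'\geq t}\mathcal{R}_i(S^{t'},A^{t'})$, $v_i^\pi(h^t) = \mathbb{E}_\pi[G^{\geq t}\mid h^t]$, $q_i^\pi(h^t,a_i) = \mathbb{E}_\pi[\mathcal{R}_i(S^t,A^t) + v_i^\pi(H^{t+1})\mid h^t, a_i]$, and the action value at a decision point is $q_i^\pi(h_i^t,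 a_i) = \mathbb{E}_\pi[q_i^\pi(H^t,a_i)\mid h_i^t]$, with $q_i^\pi(h_i)$ the vector $(q_i^\pi(h_i,a))_{a\in\mathbb{A}_i}$. $\mathrm{KL}$ is the Kullback–Leibler divergence. (At decision points reached with probability zero the update does not affect $\mathcal{J}$.) *)

(* Defs.v *)
From HB Require Import structures.
From mathcomp Require Import all_boot all_order all_algebra.
From mathcomp Require Import reals sequences.
Set Implicit Arguments. Unset Strict Implicit. Unset Printing Implicit Defensive.
Import Order.TTheory GRing.Theory Num.Theory.
Local Open Scope ring_scope.

Section POSG.
Variables (R : realType) (n : nat) (S : finType) (A O : 'I_n -> finType).

Definition JA := {dffun forall i : 'I_n, A i}.

Definition hist (i : 'I_n) := (seq (O i * A i) * O i)%type.

Definition policy := forall i : 'I_n, hist i -> A i -> R.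

Definition is_policy (pi : policy) : Prop :=
  forall i (h : hist i), (forall a, 0 <= pi i h a) /\ \sum_(a : A i) pi i h a = 1.

Variables (T : nat)
          (b0 : S -> R)
          (trans : S -> JA -> S -> R)
          (obs0 : forall i : 'I_n, S -> O i)
          (obs : forall i : 'I_n, S -> JA -> O i) (* o_i^{t+1} = O_i(s^{t+1}, a^t) *)
          (rew : 'I_n -> S -> JA -> R).

Definition is_game : Prop :=
  (forall s, 0 <= b0 s) /\ \sum_(s : S) b0 s = 1 /\
  (forall s a s', 0 <= trans s a s') /\ (forall s a, \sum_(s' : S) trans s a s' = 1).

Definition traj := (T.-tuple (S * JA))%type.

(* observation of player i at time k (d is a default, used only out of range) *)
Definition obs_at (i : 'I_n) (tau : traj) (d : S * JA) (k : nat) : O i :=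
  if k is k'.+1 then obs i (nth d tau k).1 (nth d tau k').2
  else obs0 i (nth d tau 0).1.

Definition hist_at (i : 'I_n) (tau : traj) (t : 'I_T) : hist i :=
  let d := tnth tau t in
  ([seq (obs_at i tau d k, (nth d tau k).2 i) | k <- iota 0 t], obs_at i tau d t).

Definition prob (pi : policy) (tau : traj) : R :=
  (\prod_(t < T | val t == 0%N) b0 (tnth tau t).1) *
  (\prod_(t < T | (0 < val t)%N)
      trans (nth (tnth tau t) tau t.-1).1 (nth (tnth tau t) tau t.-1).2 (tnth tau t).1) *
  (\prod_(t < T) \prod_(i < n) pi i (hist_at i tau t) ((tnth tau t).2 i)).

Definition J (i : 'I_n) (pi : policy) : R :=
  \sum_(tau : traj) prob pi tau * \sum_(t < T) rew i (tnth tau t).1 (tnth tau t).2.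

Definition reach (i : 'I_n) (pi : policy) (h : hist i) (a : A i) : R :=
  \sum_(tau : traj) \sum_(t < T | (hist_at i tau t == h) && ((tnth tau t).2 i == a))
     prob pi tau.

Definition ret_at (i : 'I_n) (pi : policy) (h : hist i) (a : A i) : R :=
  \sum_(tau : traj) \sum_(t < T | (hist_at i tau t == h) && ((tnth tau t).2 i == a))
     prob pi tau * \sum_(t' < T | (t <= t')%N) rew i (tnth tau t').1 (tnth tau t').2.

(* action value q_i^pi(h_i, a) = E_pi[G^{>=t} | h_i, a]   (0 if unreached) *)
Definition qval (i : 'I_n) (pi : policy) (h : hist i) (a : A i) : R :=
  ret_at pi h a / reach pi h a.

Definition hedge (eta : R) (pi : policy) : policy :=
  fun i h a => pi i h a * expR (eta * qval pi h a) /
               \sum_(b : A i) pi i h b * expR (eta * qval pi h b).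

End POSG.

(* Main.v *)
Require Import Defs.
From HB Require Import structures.
From mathcomp Require Import all_boot all_order all_algebra.
From mathcomp Require Import reals sequences.
From mathcomp Require Import ring.
From mathcomp Require Import boolp classical_sets functions topology normedtype.
From mathcomp Require Import derive realfun exp.
Import Order.TTheory GRing.Theory Num.Theory.
Import numFieldNormedType.Exports.
Local Open Scope ring_scope.

(** The return [J k] of the hedge update is differentiable in the stepsize
    [eta], and by the product rule its derivative at [0] is the sum over the
    players [i] of [grad k i], the expectation of the payoff of [k] times the
    sum over time of the advantages of [i]'s actions.  Letting only player [i]
    update and using the common payoff, [grad k i = grad i i].  By
    causality the rewards collected before time [t] are uncorrelated with the
    advantage of the action taken at time [t], so only the reward-to-go contributes to [grad i i], which
    is therefore a sum over the decision points of [i] of (visit probability) *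
    (variance of the action values).  Hence either the derivative is positive and
    [J k] strictly increases for small [eta], or every action value function is
    constant and the update does nothing. *)

Set Implicit Arguments.
Unset Strict Implicit.

(** * Sums over joint actions and over tuples *)

Lemma prod_sum_dffun (R : comNzSemiRingType) (I : finType) (B : I -> finType)
    (F : forall i, B i -> R) :
  \sum_(f : {dffun forall i, B i}) \prod_i F i (f i) =
  \prod_i \sum_(b : B i) F i b.
Proof.
pose P i : {ffun B i -> R} := [ffun b => F i b].
(* Through [fprod] the claim becomes distributivity for functions into a tagged union. *)
transitivity (\sum_(t : fprod B) \prod_(i in I) P i (t i)).
  rewrite (reindex (@dffun_of_fprod _ _)) /=; last exact/onW_bij/dffun_of_fprod_bij.
  by apply: eq_bigr => t _; apply: eq_bigr => i _; rewrite !ffunE.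
rewrite big_fprod -(bigA_distr_big_dep (tagged_with B) (fun i => untag 0 (P i))).
apply: eq_bigr => i _.
by rewrite -(big_tag (fun i => P i)); apply: eq_bigr => b _; rewrite ffunE.
Qed.

Lemma big_tupleS (R : Type) (idx : R) (op : Monoid.com_law idx) (X : finType)
    (m : nat) (G : m.+1.-tuple X -> R) :
  \big[op/idx]_(tau : m.+1.-tuple X) G tau =
  \big[op/idx]_(x : X) \big[op/idx]_(tau : m.-tuple X) G [tuple of x :: tau].
Proof.
rewrite pair_big /= (reindex (fun p : X * m.-tuple X => [tuple of p.1 :: p.2])) //.
exists (fun tau => (thead tau, [tuple of behead tau])) => [[x tau]|tau] _ /=.
  by rewrite theadE; congr pair; apply: val_inj.
by rewrite -tuple_eta.
Qed.

(** * Expectations over random words *)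

Section PathSums.
Variables (R : comNzRingType) (X : finType) (w : seq X -> X -> R).

(* When [w p] is the law of the next letter after the prefix [p], this is the
   expectation of [F] over random extensions of [p] by [m] letters. *)
Definition path_sum (m : nat) (p : seq X) (F : seq X -> R) : R :=
  \sum_(tau : m.-tuple X)
     (\prod_(t < m) w (p ++ take t tau) (tnth tau t)) * F (p ++ tau).

Lemma path_sum0 p F : path_sum 0 p F = F p.
Proof.
rewrite /path_sum (big_pred1 [tuple]) ?big_ord0 ?mul1r ?cats0 // => tau.
by apply/esym/eqP; rewrite tuple0.
Qed.

Lemma path_sumS m p F :
  path_sum m.+1 p F = \sum_x w p x * path_sum m (rcons p x) F.
Proof.
rewrite /path_sum big_tupleS; apply: eq_bigr => x _.
rewrite big_distrr /=; apply: eq_bigr => tau _.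
rewrite big_ord_recl /= cats0 cat_rcons mulrA; congr (_ * _ * _).
by apply: eq_bigr => t _; rewrite tnthS cat_rcons.
Qed.

Hypothesis w_sum1 : forall p, \sum_x w p x = 1.

Lemma path_sum_settled m p F :
  (forall q, F (p ++ q) = F p) -> path_sum m p F = F p.
Proof.
elim: m p => [|m IHm] p Fp; first exact: path_sum0.
rewrite path_sumS -[RHS]mul1r -(w_sum1 p) big_distrl /=.
apply: eq_bigr => x _; rewrite IHm -?cats1 ?Fp // => q.
by rewrite -catA !Fp.
Qed.

(** A martingale-difference argument: the letters after position [t] integrate out to 1, and given
    any prefix of length [t] the letter there averages [psi] to 0. *)
Lemma path_sum_mean0 (psi : seq X -> X -> R) (m : nat) (t : 'I_m) :
    (forall p, \sum_x w p x * psi p x = 0) ->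
  \sum_(tau : m.-tuple X) (\prod_(k < m) w (take k tau) (tnth tau k)) *
     psi (take t tau) (tnth tau t) = 0.
Proof.
(* The default 0 is for words without a letter at position [t]; full tuples always have one. *)
move=> psi0; pose F q := if drop t q is x :: _ then psi (take t q) x else 0.
have F0 k p : (size p <= t < size p + k)%N -> path_sum k p F = 0.
  elim: k p => [|k IHk] p; first by rewrite addn0 ltnNge andbN.
  case/andP; rewrite leq_eqVlt => /predU1P[szp _|ltpt ltk]; rewrite path_sumS.
    rewrite -{2}(psi0 p); apply: eq_bigr => x _; congr (_ * _).
    have Fpx q : F (rcons p x ++ q) = psi p x.
      by rewrite /F cat_rcons -szp take_size_cat // drop_size_cat.
    rewrite path_sum_settled => [|q]; first by rewrite -(Fpx [::]) cats0.
    by rewrite Fpx -(Fpx [::]) cats0.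
  by rewrite big1 // => x _; rewrite IHk ?mulr0 // size_rcons ltpt addSnnS.
rewrite -[RHS](F0 m [::]) ?add0n ?ltn_ord //; apply: eq_bigr => tau _ /=.
by rewrite /F (drop_nth (tnth tau t)) ?size_tuple // -tnth_nth.
Qed.

End PathSums.

(** * Derivatives at a point *)

Section Calculus.
Variable R : realType.

Lemma eq_is_derive (f g : R -> R) (x df dg : R) :
    is_derive x 1 g dg -> f =1 g -> df = dg -> is_derive x 1 f df.
Proof. by move=> gx fg ->; rewrite (_ : f = g) //; apply/funext. Qed.

Lemma is_derive_mul (f g : R -> R) (x df dg : R) :
    is_derive x 1 f df -> is_derive x 1 g dg ->
  is_derive x 1 (fun y => f y * g y) (df * g x + f x * dg).
Proof.
by move=> fx gx; have H := is_deriveM fx gx; rewrite addrC [df * _]mulrC; exact H.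
Qed.

Lemma is_derive_scale (c : R) (f : R -> R) (x df : R) :
  is_derive x 1 f df -> is_derive x 1 (fun y => c * f y) (c * df).
Proof.
move=> fx; apply: (eq_is_derive (is_derive_mul (is_derive_cst c _ _) fx)) => //.
by rewrite mul0r add0r.
Qed.

Lemma is_derive_big_sum (I : Type) (r : seq I) (F : I -> R -> R) (d : I -> R) (x : R) :
    (forall i, is_derive x 1 (F i) (d i)) ->
  is_derive x 1 (fun y => \sum_(i <- r) F i y) (\sum_(i <- r) d i).
Proof.
move=> Fd; elim: r => [|i r IHr].
  apply: (eq_is_derive (is_derive_cst 0 _ _)) => [y|]; by rewrite big_nil.
have H := is_deriveD (Fd i) IHr.
by apply: (eq_is_derive H) => [y|]; rewrite big_cons.
Qed.

(* [d i] is the logarithmic derivative of [F i]. *)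
Lemma is_derive_big_prod (I : Type) (r : seq I) (F : I -> R -> R) (d : I -> R) (x : R) :
    (forall i, is_derive x 1 (F i) (F i x * d i)) ->
  is_derive x 1 (fun y => \prod_(i <- r) F i y)
    (\prod_(i <- r) F i x * \sum_(i <- r) d i).
Proof.
move=> Fd; elim: r => [|i r IHr].
  apply: (eq_is_derive (is_derive_cst (1 : R) _ _)) => [y|]; rewrite !big_nil //.
  by rewrite mulr0.
apply: (eq_is_derive (is_derive_mul (Fd i) IHr)) => [y|];
  rewrite !big_cons //; ring.
Qed.

(** The difference quotient has a positive limit, so it is positive on a punctured neighbourhood of
    0. *)
Lemma is_derive_gt0_lt (f : R -> R) (d : R) :
    is_derive (0 : R) 1 f d -> 0 < d ->
  exists2 e : R, 0 < e & forall y, 0 < y -> y < e -> f 0 < f y.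
Proof.
move=> [df fd] d_gt0; have : (0 < 'D_1 f 0) by rewrite fd.
move=> /(cvgr_gt _ df) => -[/= e e_gt0 He].
exists e => // y y_gt0 ye.
have := He y; rewrite /= sub0r normrN gtr0_norm // => /(_ ye (lt0r_neq0 y_gt0)).
by rewrite /= addr0 [_ *: 1]mulr1 [_ *: (_ - _)]/(_ * _) pmulr_rgt0 ?invr_gt0 // subr_gt0.
Qed.

(** At 0 the normaliser is 1 and its derivative is the mean of [q]. The result has the factor [p a]
    in front, so the logarithmic derivative is the advantage. *)
Lemma is_derive_softmax (I : finType) (p q : I -> R) (a : I) :
    \sum_b p b = 1 ->
  is_derive (0 : R) 1
    (fun y => p a * expR (y * q a) / \sum_b p b * expR (y * q b))
    (p a * (q a - \sum_b p b * q b)).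
Proof.
move=> p1.
have dexp b : is_derive (0 : R) 1 (fun y => p b * expR (y * q b)) (p b * q b).
  have dq : is_derive (0 : R) 1 (fun y : R => y * q b) (q b).
    apply: (eq_is_derive (is_derive_scale (q b) (is_derive_id _ _))) => [y|].
      by rewrite mulrC.
    by rewrite mulr1.
  apply: is_derive_scale.
  have dexpq := @is_derive1_comp R expR (fun y => y * q b) 0 _ _ (is_derive_expR (0 * q b)) dq.
  by apply: (eq_is_derive dexpq) => //; rewrite mul0r expR0 mul1r.
have Z0 : \sum_b p b * expR (0 * q b) = 1.
  by rewrite -[RHS]p1; apply: eq_bigr => b _; rewrite mul0r expR0 mulr1.
have dZ := is_derive_big_sum (index_enum I) dexp.
have Z0_neq0 : \sum_b p b * expR (0 * q b) != 0 by rewrite Z0 oner_neq0.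
apply: (eq_is_derive (is_derive_mul (dexp a) (is_deriveV Z0_neq0 dZ))) => //.
by rewrite Z0 mul0r expR0 mulr1 expr1n invr1 /GRing.scale /=; ring.
Qed.

End Calculus.

Unset Implicit Arguments.
Set Strict Implicit.

(** * Factorisation of trajectory probabilities and causality *)

Section Causality.
Variables (R : realType) (n : nat) (S : finType) (A O : 'I_n -> finType).
Variables (T : nat) (b0 : S -> R) (trans : S -> JA A -> S -> R).
Variables (obs0 : forall i : 'I_n, S -> O i) (obs : forall i : 'I_n, S -> JA A -> O i).

Local Notation X := (S * JA A)%type.
Local Notation prob := (@prob R n S A O T b0 trans obs0 obs).
Local Notation hist_at := (@hist_at n S A O T obs0 obs).

Definition obs_after (i : 'I_n) (p : seq X) (d : X) (k : nat) : O i :=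
  if k is k'.+1 then obs i (nth d p k).1 (nth d p k').2
  else obs0 i (nth d p 0).1.

(* Only the state of the last pair [x] matters (its action is not observed yet),
   but taking the whole pair provides a default value for [nth]. *)
Definition hist_after (i : 'I_n) (p : seq X) (x : X) : hist A O i :=
  ([seq (obs_after i (rcons p x) x k, (nth x (rcons p x) k).2 i)
     | k <- iota 0 (size p)],
   obs_after i (rcons p x) x (size p)).

Lemma hist_after_eq_state i p x y : x.1 = y.1 -> hist_after i p x = hist_after i p y.
Proof.
move=> xy; have E k : (k < size p)%N -> nth x (rcons p x) k = nth y (rcons p y) k.
  by move=> kp; rewrite !nth_rcons kp; apply: set_nth_default.
have E1 k : (k <= size p)%N ->
    (nth x (rcons p x) k).1 = (nth y (rcons p y) k).1.
  by rewrite leq_eqVlt => /predU1P[->|/E-> //]; rewrite !nth_rcons ltnn eqxx.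
have Eo k : (k <= size p)%N ->
    obs_after i (rcons p x) x k = obs_after i (rcons p y) y k.
  by case: k => [|k] kp; rewrite /obs_after E1 // E.
congr pair; last exact: Eo.
apply/eq_in_map => k; rewrite mem_iota => /= kp.
by rewrite Eo ?E // ltnW.
Qed.

(** Non-anticipation: a decision point is determined by the past pairs and the current state, so it
    can be computed from a prefix. *)
Lemma hist_atE i (tau : traj S A T) (t : 'I_T) :
  hist_at i tau t = hist_after i (take t tau) (tnth tau t).
Proof.
set x := tnth tau t.
have tT : (t < size tau)%N by rewrite size_tuple.
have Ep : rcons (take t tau) x = take t.+1 tau.
  by rewrite (take_nth x) // -(tnth_nth x).
have E k : (k <= t)%N -> nth x (take t.+1 tau) k = nth x tau k.
  by move=> kt; rewrite nth_take.
have Eo k : (k <= t)%N ->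
    obs_after i (take t.+1 tau) x k = obs_at obs0 obs i tau x k.
  case: k => [|k] kt; rewrite /obs_after /obs_at E //.
  by rewrite E // ltnW.
rewrite /hist_after /Defs.hist_at -/x Ep size_takel ?(ltnW tT) //.
congr pair; last by rewrite Eo.
apply/eq_in_map => k; rewrite mem_iota => /= kp.
by rewrite Eo ?E // ltnW.
Qed.

(** An empty prefix stands for time 0. In [last x p] the default [x] is never reached, so only the
    state of [x] matters. *)
Definition state_weight (p : seq X) (x : X) : R :=
  if nilp p then b0 x.1 else trans (last x p).1 (last x p).2 x.1.

Definition step_weight (pi : policy R A O) (p : seq X) (x : X) : R :=
  state_weight p x * \prod_i pi i (hist_after i p x) (x.2 i).

Lemma probE pi (tau : traj S A T) :
  prob pi tau = \prod_(t < T) step_weight pi (take t tau) (tnth tau t).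
Proof.
rewrite /Defs.prob /step_weight big_split /=; congr (_ * _); last first.
  by apply: eq_bigr => t _; apply: eq_bigr => i _; rewrite hist_atE.
rewrite (big_mkcond (fun t : 'I_T => val t == 0%N)).
rewrite (big_mkcond (fun t : 'I_T => (0 < val t)%N)) -big_split /=.
apply: eq_bigr => t _; rewrite /state_weight /nilp.
have tT : (t < size tau)%N by rewrite size_tuple.
rewrite size_takel ?(ltnW tT) //; have [_|t0] := posnP t; first by rewrite mulr1.
rewrite mul1r -nth_last size_takel ?(ltnW tT) //.
by rewrite nth_take // prednK.
Qed.

Hypothesis game : is_game b0 trans.
Variable pi : policy R A O.
Hypothesis pi_policy : is_policy pi.

Lemma prob_ge0 tau : 0 <= prob pi tau.
Proof.
have [b0_ge0 [_ [tr_ge0 _]]] := game.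
apply: mulr_ge0; first by apply: mulr_ge0; apply: prodr_ge0 => t _.
by apply: prodr_ge0 => t _; apply: prodr_ge0 => i _; case: (pi_policy i (hist_at i tau t)).
Qed.

Lemma state_weight_sum1 p (c : S -> JA A) :
  \sum_s state_weight p (s, c s) = 1.
Proof.
have [_ [b01 [_ tr1]]] := game; rewrite /state_weight.
case: nilP => [//|]; case: p => //= y p _; exact: tr1.
Qed.

Lemma sum_step_weight (F : seq X -> X -> R) p :
  \sum_x step_weight pi p x * F p x =
  \sum_s \sum_(a : JA A) step_weight pi p (s, a) * F p (s, a).
Proof. by rewrite pair_big /=; apply: eq_bigr => -[]. Qed.

(* The product of the policies has total mass [1], so its index set is nonempty. *)
Lemma JA_inhabited (s : S) : {a : JA A | true}.
Proof.
have: \sum_(a : JA A) \prod_i pi i ([::], obs0 i s) (a i) = 1.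
  rewrite (prod_sum_dffun (fun i => pi i ([::], obs0 i s))) big1 // => i _.
  by case: (pi_policy i ([::], obs0 i s)).
case: (pickP (predT : pred (JA A))) => [a _ _|no]; first by exists a.
by rewrite big_pred0 // => /esym/eqP; rewrite oner_eq0.
Qed.

Lemma step_weight_sum1 p : \sum_x step_weight pi p x = 1.
Proof.
transitivity (\sum_x step_weight pi p x * (fun _ _ => 1) p x).
  by apply: eq_bigr => x _; rewrite mulr1.
rewrite (sum_step_weight (fun _ _ => 1)).
rewrite -[RHS](state_weight_sum1 p (fun s => sval (JA_inhabited s))).
apply: eq_bigr => s _; case: (JA_inhabited s) => a0 _ /=.
transitivity (\sum_(a : JA A) state_weight p (s, a0) *
    \prod_i pi i (hist_after i p (s, a0)) (a i)).
  apply: eq_bigr => a _; rewrite /= mulr1 /step_weight; congr (_ * _).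
    by rewrite /state_weight; case: (p).
  by apply: eq_bigr => i _; rewrite (@hist_after_eq_state i p _ (s, a0)).
rewrite -big_distrr (prod_sum_dffun (fun i => pi i (hist_after i p (s, a0)))).
rewrite big1 /= ?mulr1 // => i _.
by case: (pi_policy i (hist_after i p (s, a0))).
Qed.

(** Given the current state the players randomise independently, so the sum over joint actions
    factorises and the factor of player [i] is the mean of [g], which is 0. The factor [phi] may
    depend on the past and the current state, but not on the current action. *)
Lemma step_weight_mean0 i (phi : seq X -> X -> R) (g : hist A O i -> A i -> R) p :
    (forall s a a', phi p (s, a) = phi p (s, a')) ->
    (forall h, \sum_a pi i h a * g h a = 0) ->
  \sum_x step_weight pi p x * (phi p x * g (hist_after i p x) (x.2 i)) = 0.
Proof.
move=> phi_eq g0.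
rewrite (sum_step_weight (fun p x => phi p x * g (hist_after i p x) (x.2 i))).
apply: big1 => s _; case: (JA_inhabited s) => a0 _.
set h := fun j => hist_after j p (s, a0).
(* The factor of player [i] absorbs [g]; the other factors stay the policies. *)
pose G := dfwith (fun j => pi j (h j)) (fun b => pi i (h i) b * g (h i) b).
transitivity (\sum_(a : JA A) state_weight p (s, a0) * phi p (s, a0) *
    \prod_j G j (a j)).
  apply: eq_bigr => a _; rewrite (phi_eq s a a0) /step_weight.
  rewrite !(@hist_after_eq_state i p (s, a) (s, a0)) //=.
  have -> : state_weight p (s, a) = state_weight p (s, a0).
    by rewrite /state_weight; case: (p).
  rewrite (bigD1 i) //= [\prod_j G _ _](bigD1 i) //= /G dfwith_in.
  rewrite (eq_bigr (fun j => dfwith (fun j => pi j (h j))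
      (fun b => pi i (h i) b * g (h i) b) j (a j))) => [|j ij]; last first.
    by rewrite dfwith_out 1?eq_sym // /h (@hist_after_eq_state j p (s, a) (s, a0)).
  rewrite (@hist_after_eq_state i p (s, a) (s, a0)) // -/(h i).
  ring.
rewrite -big_distrr (prod_sum_dffun G) (bigD1 i) //= /G dfwith_in g0.
by rewrite mul0r mulr0.
Qed.

Lemma prob_mean0 i (phi : seq X -> X -> R) (g : hist A O i -> A i -> R) (t : 'I_T) :
    (forall p s a a', phi p (s, a) = phi p (s, a')) ->
    (forall h, \sum_a pi i h a * g h a = 0) ->
  \sum_tau prob pi tau * (phi (take t tau) (tnth tau t) *
     g (hist_at i tau t) ((tnth tau t).2 i)) = 0.
Proof.
move=> phi_eq g0.
under eq_bigr => tau _ do rewrite probE hist_atE.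
apply: (@path_sum_mean0 _ _ _ step_weight_sum1
  (fun p x => phi p x * g (hist_after i p x) (x.2 i))) => p.
exact: step_weight_mean0.
Qed.

End Causality.

(** * Policy gradient along the hedge update *)

Section PolicyGradient.
Variables (R : realType) (n : nat) (S : finType) (A O : 'I_n -> finType).
Variables (T : nat) (b0 : S -> R) (trans : S -> JA A -> S -> R).
Variables (obs0 : forall i : 'I_n, S -> O i) (obs : forall i : 'I_n, S -> JA A -> O i).
Implicit Types (i k : 'I_n) (M : pred 'I_n).
Variables (rew : 'I_n -> S -> JA A -> R) (pi : policy R A O).

Local Notation traj := (@traj n S A T).
Local Notation prob := (@prob R n S A O T b0 trans obs0 obs).
Local Notation hist_at := (@hist_at n S A O T obs0 obs).
Local Notation J := (@J R n S A O T b0 trans obs0 obs rew).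
Local Notation hedge := (@hedge R n S A O T b0 trans obs0 obs rew).
Local Notation q i := (@qval R n S A O T b0 trans obs0 obs rew i pi).
Local Notation reach i := (@reach R n S A O T b0 trans obs0 obs i pi).
Local Notation ret_at i := (@ret_at R n S A O T b0 trans obs0 obs rew i pi).

Hypothesis game : is_game b0 trans.
Hypothesis pi_policy : is_policy pi.
Hypothesis pi_gt0 : forall i (h : hist A O i) (a : A i), 0 < pi i h a.

Definition adv (i : 'I_n) (h : hist A O i) (a : A i) : R :=
  q i h a - \sum_b pi i h b * q i h b.

Definition payoff (k : 'I_n) (tau : traj) : R :=
  \sum_(t < T) rew k (tnth tau t).1 (tnth tau t).2.

(** Likelihood-ratio form: the summed advantages are the logarithmic derivative of the probability
    of [tau] when only player [i] updates. *)
Definition grad (k i : 'I_n) : R :=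
  \sum_(tau : traj) prob pi tau *
    (\sum_(t < T) adv i (hist_at i tau t) ((tnth tau t).2 i)) * payoff k tau.

(** A singleton [M] isolates the contribution of one player; [predT] gives the full update. *)
Definition hedge_on (M : pred 'I_n) (eta : R) : policy R A O :=
  fun i h a => if M i then hedge eta pi h a else pi i h a.

Let pi_sum1 i h : \sum_a pi i h a = 1.
Proof. by case: (pi_policy i h). Qed.

Lemma adv_mean0 i h : \sum_a pi i h a * adv i h a = 0.
Proof.
rewrite /adv; under eq_bigr do rewrite mulrBr.
by rewrite sumrB -big_distrl /= pi_sum1 mul1r subrr.
Qed.

Lemma hedge_on0 M : hedge_on M 0 = pi.
Proof.
apply: functional_extensionality_dep => i; apply/funext => h; apply/funext => a.
rewrite /hedge_on /Defs.hedge; case: (M i) => //.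
under eq_bigr do rewrite mul0r expR0 mulr1.
by rewrite mul0r expR0 mulr1 pi_sum1 divr1.
Qed.

Lemma hedge_on_policy M eta : is_policy (hedge_on M eta).
Proof.
move=> i h; rewrite /hedge_on; case: (M i) => //; rewrite /Defs.hedge.
have w_gt0 a : 0 < pi i h a * expR (eta * q i h a) by rewrite mulr_gt0 ?expR_gt0.
have Z_ge0 : 0 <= \sum_a pi i h a * expR (eta * q i h a).
  by apply: sumr_ge0 => a _; exact: ltW.
split=> [a|]; first by rewrite divr_ge0 // ltW.
rewrite -big_distrl /= mulfV // psumr_neq0 => [|a _]; last exact: ltW.
(* Some action exists because the probabilities at [h] sum to 1. *)
apply/hasP; case: (pickP (predT : pred (A i))) => [a _|no].
  by exists a; [exact: mem_index_enum | exact: w_gt0].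
by have := pi_sum1 i h; rewrite big_pred0 // => /esym/eqP; rewrite oner_eq0.
Qed.

Lemma is_derive_hedge_on M i h a :
  is_derive (0 : R) 1 (fun eta => hedge_on M eta i h a)
    (hedge_on M 0 i h a * (if M i then adv i h a else 0)).
Proof.
rewrite hedge_on0 /hedge_on; case: (M i); first exact: is_derive_softmax.
by rewrite mulr0; exact: is_derive_cst.
Qed.

Lemma is_derive_prob M tau :
  is_derive (0 : R) 1 (fun eta => prob (hedge_on M eta) tau)
    (prob pi tau * \sum_(t < T) \sum_i
       if M i then adv i (hist_at i tau t) ((tnth tau t).2 i) else 0).
Proof.
rewrite -{1}(hedge_on0 M) /Defs.prob -mulrA.
apply: is_derive_scale; apply: is_derive_big_prod => t.
by apply: is_derive_big_prod => i; exact: is_derive_hedge_on.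
Qed.

Lemma is_derive_J M k :
  is_derive (0 : R) 1 (fun eta => J k (hedge_on M eta)) (\sum_(i | M i) grad k i).
Proof.
rewrite /Defs.J; pose d tau := prob pi tau * (\sum_(t < T) \sum_i
  if M i then adv i (hist_at i tau t) ((tnth tau t).2 i) else 0).
have H tau : is_derive (0 : R) 1 (fun eta => prob (hedge_on M eta) tau * payoff k tau)
    (d tau * payoff k tau).
  rewrite mulrC; apply: (eq_is_derive
    (is_derive_scale (payoff k tau) (is_derive_prob M tau))) => // y.
  exact: mulrC.
apply: (eq_is_derive (is_derive_big_sum (index_enum traj) H)) => //.
rewrite /grad exchange_big /=; apply: eq_bigr => tau _.
rewrite /d -big_distrl -big_distrr /=; congr (_ * _ * _).
rewrite [RHS]exchange_big big_mkcond; apply: eq_bigr => i _ /=.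
by case: (M i); rewrite // big1.
Qed.

(** A history at time [t] records [t] past pairs, so a trajectory meets [h] at most once and this is
    a probability. *)
Definition visits (i : 'I_n) (h : hist A O i) : R :=
  \sum_(tau : traj) \sum_(t < T | hist_at i tau t == h) prob pi tau.

(** Causality, applied to the indicator of being at [h] and the centred indicator of playing [a]. *)
Lemma reachE i h a : reach i h a = pi i h a * visits i h.
Proof.
pose phi p x : R := (hist_after n S A O obs0 obs i p x == h)%:R.
pose g h' b : R := (b == a)%:R - pi i h' a.
have phi_eq p s c c' : phi p (s, c) = phi p (s, c').
  by rewrite /phi (@hist_after_eq_state _ _ _ _ _ _ i p (s, c) (s, c')).
have g0 h' : \sum_b pi i h' b * g h' b = 0.
  rewrite /g; under eq_bigr do rewrite mulrBr.
  rewrite sumrB -big_distrl /= pi_sum1 mul1r (bigD1 a) //= eqxx mulr1.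
  rewrite big1 ?addr0 ?subrr //.
  by move=> b /negPf->; rewrite mulr0.
apply/eqP; rewrite -subr_eq0; apply/eqP.
rewrite /Defs.reach /visits big_distrr -sumrB /=.
transitivity (\sum_(t < T) \sum_tau prob pi tau *
    (phi (take t tau) (tnth tau t) * g (hist_at i tau t) ((tnth tau t).2 i))).
  rewrite exchange_big /=; apply: eq_bigr => tau _.
  rewrite big_mkcondr big_distrr -sumrB /= [LHS]big_mkcond; apply: eq_bigr => t _.
  rewrite /phi -hist_atE /g; case: eqP => [->|_]; last by rewrite mul0r mulr0.
  by case: eqP => _ /=; ring.
by apply: big1 => t _; exact: prob_mean0.
Qed.

(** If [reach] is 0, every contributing trajectory has probability 0, so [ret_at] is 0 too and
    agrees with the default value of the division. *)
Lemma ret_atE i h a : ret_at i h a = reach i h a * q i h a.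
Proof.
rewrite /qval; have [r0|r_neq0] := eqVneq (reach i h a) 0; last by rewrite mulrC divfK.
rewrite r0 mul0r; apply: big1 => tau _; apply: big1 => t ht.
have P0 tau' (t' : 'I_T) : 0 <= prob pi tau' by exact: prob_ge0.
have r_ge0 tau' : 0 <= \sum_(t' < T | (hist_at i tau' t' == h)
    && ((tnth tau' t').2 i == a)) prob pi tau'.
  by apply: sumr_ge0 => t' _; exact: prob_ge0.
have /(psumr_eq0P (fun tau' _ => r_ge0 tau')) /(_ tau isT) := r0.
move=> /(psumr_eq0P (fun t' _ => P0 tau t')) /(_ t ht) ->.
by rewrite mul0r.
Qed.

(* There [reach] vanishes as well, so [qval] is a division by zero, i.e. [0]. *)
Lemma visits_eq0 i h : visits i h = 0 -> forall a, adv i h a = 0.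
Proof.
move=> v0 a; have q0 b : q i h b = 0 by rewrite /qval reachE v0 mulr0 invr0 mulr0.
by rewrite /adv q0 big1 ?subrr // => b _; rewrite q0 mulr0.
Qed.

(** Rewards before [t] are fixed when the action at [t] is drawn, and the advantage has mean 0 at
    each decision point. *)
Lemma past_payoff_mean0 i (t : 'I_T) :
  \sum_(tau : traj) prob pi tau *
    (adv i (hist_at i tau t) ((tnth tau t).2 i) *
     \sum_(t' < T | (t' < t)%N) rew i (tnth tau t').1 (tnth tau t').2) = 0.
Proof.
pose phi (p : seq (S * JA A)) (x : S * JA A) := \sum_(y <- p) rew i y.1 y.2.
rewrite -[RHS](prob_mean0 _ _ _ _ _ _ _ _ obs0 obs game pi pi_policy i phi
  (adv i) t) //; last exact: adv_mean0.
apply: eq_bigr => tau _; congr (_ * _); rewrite mulrC; congr (_ * _).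
set d := tnth tau t; have tT := ltnW (ltn_ord t).
rewrite /phi (big_nth d) size_takel ?size_tuple // big_mkord.
rewrite (big_ord_widen T (fun j =>
  rew i (nth d (take t tau) j).1 (nth d (take t tau) j).2)) //.
by apply: eq_bigr => t' tt'; rewrite nth_take // -tnth_nth.
Qed.

Lemma grad_selfE i :
  grad i i = \sum_(tau : traj) \sum_(t < T)
    adv i (hist_at i tau t) ((tnth tau t).2 i) * (prob pi tau *
    \sum_(t' < T | (t <= t')%N) rew i (tnth tau t').1 (tnth tau t').2).
Proof.
(* This 0 becomes the sum of the past-reward terms, which completes the reward-to-go to the full
   payoff. *)
rewrite -[RHS]addr0.
have past0 : \sum_(t < T) \sum_(tau : traj) prob pi tau *
    (adv i (hist_at i tau t) ((tnth tau t).2 i) *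
     \sum_(t' < T | (t' < t)%N) rew i (tnth tau t').1 (tnth tau t').2) = 0.
  by apply: big1 => t _; exact: past_payoff_mean0.
rewrite -[X in _ + X]past0 [in X in _ + X]exchange_big -big_split /=; apply: eq_bigr => tau _.
rewrite -mulrA big_distrl big_distrr -big_split /=; apply: eq_bigr => t _.
rewrite /payoff (bigID (fun t' : 'I_T => (t <= t')%N)) /=.
under [X in _ + X]eq_bigl do rewrite -ltnNge.
ring.
Qed.

(* [H] is needed because [hist A O i] is infinite: it lists the decision points
   that occur on some trajectory. *)
Lemma grad_self_visits i :
  exists2 H : seq (hist A O i), (forall h, visits i h != 0 -> h \in H) &
  grad i i = \sum_(h <- H) visits i h * \sum_a pi i h a * adv i h a ^+ 2.
Proof.
pose H := undup [seq hist_at i p.1 p.2 | p : traj * 'I_T].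
exists H.
  move=> h; apply: contraNT => hH; apply/eqP; apply: big1 => tau _.
  apply: big1 => t /eqP ht; case/negP: hH; rewrite mem_undup -ht.
  by apply/fintype.imageP; exists (tau, t).
(* The pairs of a trajectory and a time are grouped by the history and action seen there; each pair
   lies in exactly one group. *)
transitivity (\sum_(h <- H) \sum_a adv i h a * ret_at i h a).
  rewrite grad_selfE.
  under [RHS]eq_bigr => h _ do under eq_bigr => a _ do rewrite big_distrr.
  under [RHS]eq_bigr => h _ do rewrite exchange_big.
  rewrite [RHS]exchange_big /=; apply: eq_bigr => tau _.
  under [RHS]eq_bigr => h _ do under eq_bigr => a _ do rewrite big_distrr /= big_mkcond /=.
  under [RHS]eq_bigr => h _ do rewrite exchange_big.
  rewrite [RHS]exchange_big /=; apply: eq_bigr => t _.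
  have ht : hist_at i tau t \in H.
    by rewrite mem_undup; apply/fintype.imageP; exists (tau, t).
  rewrite (bigD1_seq _ ht (undup_uniq _)) /=.
  rewrite [X in _ + X]big1 ?addr0 => [|h]; last first.
    by rewrite eq_sym => /negPf h'; rewrite big1 // => a _; rewrite h'.
  rewrite (bigD1 ((tnth tau t).2 i)) //= !eqxx [X in _ + X]big1 ?addr0 // => a.
  by rewrite eq_sym => /negPf ->.
apply: eq_bigr => h _; rewrite big_distrr /=.
set m := \sum_b pi i h b * q i h b.
(* Splitting [q] as [adv] plus its mean [m] leaves the variance; the part with [m] vanishes by
   [adv_mean0]. *)
have -> : \sum_a adv i h a * ret_at i h a =
    \sum_a visits i h * (pi i h a * adv i h a ^+ 2) +
    visits i h * m * \sum_a pi i h a * adv i h a.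
  rewrite big_distrr -big_split /=; apply: eq_bigr => a _.
  by rewrite ret_atE reachE /adv -/m; ring.
by rewrite adv_mean0 mulr0 addr0.
Qed.

Lemma visits_ge0 i h : 0 <= visits i h.
Proof. by apply: sumr_ge0 => tau _; apply: sumr_ge0 => t _; exact: prob_ge0. Qed.

Lemma grad_self_ge0 i : 0 <= grad i i.
Proof.
have [H _ ->] := grad_self_visits i; apply: sumr_ge0 => h _.
rewrite mulr_ge0 ?visits_ge0 // sumr_ge0 // => a _.
by rewrite mulr_ge0 ?sqr_ge0 // ltW.
Qed.

Lemma grad_self_eq0 i : grad i i = 0 -> forall h a, adv i h a = 0.
Proof.
have [H mem_H ->] := grad_self_visits i.
have var_ge0 h a : 0 <= pi i h a * adv i h a ^+ 2 by rewrite mulr_ge0 ?sqr_ge0 // ltW.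
move=> /eqP; rewrite psumr_eq0 => [/allP /= all0 h a|h _]; last first.
  by rewrite mulr_ge0 ?visits_ge0 // sumr_ge0.
have [/visits_eq0-> //|v_neq0] := eqVneq (visits i h) 0.
have := all0 h (mem_H h v_neq0); rewrite mulf_eq0 (negPf v_neq0) /= => /eqP.
move=> /(psumr_eq0P (fun a _ => var_ge0 h a)) /(_ a isT) /eqP.
by rewrite mulf_eq0 gt_eqF //= sqrf_eq0 => /eqP.
Qed.

(** Action values that do not depend on the action cancel against the normaliser. *)
Lemma hedge_adv0 eta : (forall i h a, adv i h a = 0) -> hedge eta pi = pi.
Proof.
move=> adv0; apply: functional_extensionality_dep => i.
apply/funext => h; apply/funext => a; rewrite /Defs.hedge.
have qE b : q i h b = q i h a.
  transitivity (\sum_c pi i h c * q i h c); apply/eqP; rewrite -subr_eq0.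
    by apply/eqP; exact: adv0.
  by rewrite -opprB oppr_eq0; apply/eqP; exact: adv0.
under eq_bigr do rewrite qE.
by rewrite -big_distrl /= pi_sum1 mul1r mulfK // gt_eqF // expR_gt0.
Qed.

Hypothesis common_payoff : forall pi' : policy R A O, is_policy pi' ->
  forall i j, J i pi' = J j pi'.

(** When [i] alone updates, the curve stays among policies, where [J k] and [J i] agree; equal
    functions have equal derivatives. *)
Lemma grad_common k i : grad k i = grad i i.
Proof.
have dJ j := is_derive_J (pred1 i) j.
have E : (fun eta => J k (hedge_on (pred1 i) eta)) =
    (fun eta => J i (hedge_on (pred1 i) eta)).
  by apply/funext => eta; apply: common_payoff; exact: hedge_on_policy.
have := @derive_val _ _ _ _ _ _ _ (dJ k); rewrite E (@derive_val _ _ _ _ _ _ _ (dJ i)).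
by rewrite !big_pred1_eq.
Qed.

Lemma is_derive_hedge k :
  is_derive (0 : R) 1 (fun eta => J k (hedge eta pi)) (\sum_i grad i i).
Proof.
rewrite (eq_bigr (grad k)) => [|i _]; last by rewrite grad_common.
exact: (is_derive_J predT k).
Qed.

End PolicyGradient.

(** * Monotone improvement *)

Theorem theorem1 (R : realType) (n : nat) (S : finType) (A O : 'I_n -> finType)
    (T : nat) (b0 : S -> R) (trans : S -> JA A -> S -> R)
    (obs0 : forall i : 'I_n, S -> O i) (obs : forall i : 'I_n, S -> JA A -> O i)
    (rew : 'I_n -> S -> JA A -> R) (pi : policy R A O) :
  is_game b0 trans ->
  (* common payoff: all players' expected returns coincide for every joint policy *)
  (forall pi' : policy R A O, is_policy pi' ->
     forall i j, J T b0 trans obs0 obs rew i pi' = J T b0 trans obs0 obs rew j pi') ->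
  is_policy pi ->
  (forall i (h : hist A O i) (a : A i), 0 < pi i h a) ->
  exists eta0 : R, 0 < eta0 /\
    forall eta : R, 0 < eta -> eta < eta0 ->
      let pi' := hedge T b0 trans obs0 obs rew eta pi in
      (forall i, J T b0 trans obs0 obs rew i pi <= J T b0 trans obs0 obs rew i pi') /\
      (pi' <> pi ->
         forall i, J T b0 trans obs0 obs rew i pi < J T b0 trans obs0 obs rew i pi').
Proof.
move=> game common pi_policy pi_gt0.
pose D := \sum_i grad R n S A O T b0 trans obs0 obs rew pi i i.
have grad_ge0 i : 0 <= grad R n S A O T b0 trans obs0 obs rew pi i i.
  exact: grad_self_ge0.
(* A zero sum of nonnegative gradients kills every advantage, so [pi] is fixed for every stepsize
   and the bound 1 is arbitrary. *)
have [D0|D_neq0] := eqVneq D 0.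
  have fixed eta : hedge T b0 trans obs0 obs rew eta pi = pi.
    apply: hedge_adv0 => // i; apply: grad_self_eq0 => //.
    exact: (psumr_eq0P (fun i _ => grad_ge0 i) D0).
  by exists 1; split=> // eta _ _; rewrite fixed.
have D_gt0 : 0 < D by rewrite lt_def D_neq0 sumr_ge0.
(* The derivative is taken for one player [k] and transferred to the others by the common payoff;
   without players both claims are vacuous. *)
have [k _|no_player] := pickP (predT : pred 'I_n); last first.
  by exists 1; split=> // eta _ _; split=> [i|_ i]; have := no_player i.
have dJ : is_derive (0 : R) 1
    (fun eta => J T b0 trans obs0 obs rew k (hedge T b0 trans obs0 obs rew eta pi)) D.
  exact: is_derive_hedge.
have hedge0 : hedge T b0 trans obs0 obs rew 0 pi = pi.
  exact: (hedge_on0 R n S A O T b0 trans obs0 obs rew pi pi_policy predT).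
have [eta0 eta0_gt0 J_lt] := is_derive_gt0_lt dJ D_gt0.
exists eta0; split=> // eta eta_gt0 lt_eta pi'.
have J_lt_all i : J T b0 trans obs0 obs rew i pi < J T b0 trans obs0 obs rew i pi'.
  have pi'_policy : is_policy pi'.
    exact: (hedge_on_policy R n S A O T b0 trans obs0 obs rew pi pi_policy pi_gt0 predT eta).
  rewrite (common pi pi_policy i k) (common pi' pi'_policy i k).
  by have := J_lt eta eta_gt0 lt_eta; rewrite hedge0.
by split=> [i|_ //]; exact: ltW.
Qed.
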